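(* Let $\mathcal{H}$ be an $r$-uniform $r$-partite linear hypergraph ($r\ge 3$). If $\mathcal{H}$ is $\mathcal{G}_r(3r-3,3)$-free, then it is also $\mathcal{G}_r(4r-5,4)$-free.
   Context: A hypergraph is linear if any two distinct edges share at most one vertex. An $r$-uniform hypergraph is $r$-partite if its vertex set is partitioned into $r$ parts such that every edge contains exactly one vertex of each part. An $r$-uniform hypergraph is $\mathcal{G}_r(v,e)$-free if the union of any $e$ distinct edges has at least $v+1$ vertices. *)

(* Defs.v *)
From mathcomp Require Import all_boot.

Set Implicit Arguments.
Unset Strict Implicit.
Unset Printing Implicit Defensive.

(* A finite hypergraph with vertex set T is given by its set of edges
   H : {set {set T}}; there are no repeated edges. *)

Definition uniform (T : finType) (r : nat) (H : {set {set T}}) : Prop :=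
  forall A : {set T}, A \in H -> #|A| = r.

Definition linear_hypergraph (T : finType) (H : {set {set T}}) : Prop :=
  forall A B : {set T}, A \in H -> B \in H -> A != B -> #|A :&: B| <= 1.

(* The parts are an indexed family rather than a finset.partition, so a part
   may be empty; this can only happen when there are no edges. *)
Definition partite (T : finType) (r : nat) (H : {set {set T}}) : Prop :=
  exists V : 'I_r -> {set T},
    [/\ \bigcup_(i < r) V i = [set: T],
        forall i j : 'I_r, i != j -> [disjoint V i & V j]
      & forall (A : {set T}) (i : 'I_r), A \in H -> #|A :&: V i| = 1].

(* The property G_r(v, e)-free; the index r only records the uniformity of H,
   which is a separate hypothesis. *)
Definition G_free (T : finType) (v e : nat) (H : {set {set T}}) : Prop :=
  forall F : {set {set T}}, F \subset H -> #|F| = e -> v + 1 <= #|cover F|.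

(* Main.v *)
(* If some edge of a four-edge subhypergraph meets the union of the other three
   in at most 2 vertices, then the four edges span at least
   (3r - 2) + (r - 2) = 4r - 4 vertices.  Otherwise linearity forces each edge
   to meet the other three in three distinct vertices, so any three of the edges
   form a triangle, spanning only 3r - 3 vertices. *)
Require Import Defs.
From mathcomp Require Import all_boot zify.

Set Implicit Arguments.
Unset Strict Implicit.
Unset Printing Implicit Defensive.

Lemma cards3P (T : finType) (F : {set T}) :
  #|F| = 3 ->
  exists x y z, [/\ x != y, x != z, y != z & F = [set x; y; z]].
Proof.
move=> F3.
have [x xF] : exists x, x \in F by apply/card_gt0P; rewrite F3.
have : #|F :\ x| == 2 by have := cardsD1 x F; rewrite xF F3; lia.
case/cards2P=> y [z [yz FxE]].
have : y \in F :\ x by rewrite FxE set21.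
have : z \in F :\ x by rewrite FxE set22.
rewrite !in_setD1 => /andP[zx _] /andP[yx _].
exists x, y, z; split=> //; rewrite 1?eq_sym //.
by rewrite -setUA -FxE setD1K.
Qed.

Lemma cover3 (T : finType) (A B C : {set T}) :
  cover [set A; B; C] = A :|: B :|: C.
Proof. by rewrite /cover !bigcup_setU !big_set1. Qed.

Lemma G_free3_union (T : finType) (v : nat) (H : {set {set T}})
    (A B C : {set T}) :
    G_free v 3 H -> A \in H -> B \in H -> C \in H ->
    A != B -> A != C -> B != C ->
  v < #|A :|: B :|: C|.
Proof.
move=> free AH BH CH AB AC BC.
rewrite -cover3 -addn1; apply: free.
  by rewrite !subUset !sub1set AH BH CH.
by rewrite -setUA cardsU1 cards2 !inE negb_or AB AC BC.
Qed.

(** Used to split the trace of an edge on a union of edges into pairwise intersections, each of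
    which linearity bounds by 1. *)
Lemma card_setIU (T : finType) (A B C : {set T}) :
  #|A :&: (B :|: C)| <= #|A :&: B| + #|A :&: C|.
Proof. by rewrite setIUr cardsU leq_subr. Qed.

Theorem theorem12 (T : finType) (r : nat) (H : {set {set T}})
  (hr : 3 <= r)
  (Huniform : uniform r H)
  (Hpartite : partite r H)
  (Hlinear : linear_hypergraph H)
  (Hfree : G_free (3 * r - 3) 3 H) :
  G_free (4 * r - 5) 4 H.
Proof.
move=> F FH F4.
have [D DF] : exists D, D \in F by apply/card_gt0P; rewrite F4.
have : #|F :\ D| = 3 by have := cardsD1 D F; rewrite DF F4; lia.
case/cards3P=> A [B [C [AB AC BC FDE]]].
have /and3P[AFD BFD CFD] :
    [&& A \in F :\ D, B \in F :\ D & C \in F :\ D].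
  by rewrite FDE !inE !eqxx !orbT.
move: AFD BFD CFD; rewrite !in_setD1.
move=> /andP[AD /(subsetP FH) AH] /andP[BD /(subsetP FH) BH].
move=> /andP[CD /(subsetP FH) CH].
have DH := subsetP FH _ DF.
have -> : cover F = D :|: (A :|: B :|: C).
  by rewrite -(setD1K DF) FDE -(cover3 A) /cover bigcup_setU big_set1.
have rA := Huniform _ AH; have rB := Huniform _ BH; have rD := Huniform _ DH.
have [meetD|meetD] := leqP #|D :&: (A :|: B :|: C)| 2.
  have := G_free3_union Hfree AH BH CH AB AC BC.
  have := cardsUI D (A :|: B :|: C).
  clear -hr rD meetD; lia.
(* Only [D] and [A] need testing: the contradiction below comes from the triangle [A], [B], [D]. *)
have [meetA|meetA] := leqP #|A :&: (B :|: C :|: D)| 2.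
  have := G_free3_union Hfree BH CH DH BC BD CD.
  have := cardsUI A (B :|: C :|: D).
  have -> : D :|: (A :|: B :|: C) = A :|: (B :|: C :|: D).
    by rewrite setUC !setUA.
  clear -hr rA meetA; lia.
(* Of the at least 3 vertices where [D] meets the others, [C] accounts for at most one. *)
have DAB : 2 <= #|D :&: (A :|: B)|.
  have DC : #|D :&: C| <= 1 by apply: Hlinear; rewrite // eq_sym.
  by have := leq_trans meetD (card_setIU _ _ _); clear -DC; lia.
(* [C] and [D] each account for at most one of the at least 3 vertices on [A], so one is left for
   [B]. *)
have AB_gt0 : 1 <= #|A :&: B|.
  have lAC := Hlinear _ _ AH CH AC; have lAD := Hlinear _ _ AH DH AD.
  have := leq_trans meetA (card_setIU _ _ _); have := card_setIU A B C.
  clear -lAC lAD; lia.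
(* [A] and [B] span at most [2r - 1] vertices and [D] adds at most [r - 2], so the three edges span
   at most [3r - 3], against freeness. *)
have := G_free3_union Hfree AH BH DH AB AD BD.
have := cardsUI (A :|: B) D; have := cardsUI A B.
rewrite [_ :&: D]setIC.
clear -hr rA rB rD DAB AB_gt0; lia.
Qed.
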